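(* Let $J$ be a finite set with $m:=|J|\ge 2$, let $\Pi=(P_x)_{x\in J}$ be a partition of a finite set $P$ of participants, and let $\mathcal{Z}=(J,h,\boldsymbol g)$ be a uniform polymatroid with increment sequence $\boldsymbol g=(g_i)_{0\le i\le m}$ such that $g_0\ge g_1>g_2=0$ and $g_0<|P_x|$ for all $x\in J$. For $S\subseteq J$ let $\mathcal{P}_k(S)$ denote the collection of all $k$-element subsets of $S$. 1. If $g_0>g_1$, then a monotone increasing family $\Delta\subseteq\mathcal{P}(J)\setminus\{\emptyset\}$ is compatible with $\mathcal{Z}$ if and only if there is a subset $X\subseteq J$ such that $\min\Delta=\mathcal{P}_1(X)\cup\mathcal{P}_2(J\setminus X)$. 2. If $g_0=g_1$, then a monotone increasing family $\Delta\subseteq\mathcal{P}(J)\setminus\{\emptyset\}$ is compatible with $\mathcal{Z}$ if and only if there is a subset $X\subseteq J$ with $|X|\le 1$ such that $\min\Delta=\mathcal{P}_1(X)\cup\mathcal{P}_2(J\setminus X)$. 3. Let $\Delta\subseteq\mathcal{P}(J)\setminus\{\emptyset\}$ be a monotone increasing family, compatible with $\mathcal{Z}$, such that $\min\Delta=\mathcal{P}_1(X)\cup\mathcal{P}_2(J\setminus X)$ for some $X\subseteq J$, and let $\Gamma=\Gamma(\Pi,\mathcal{Z},\Delta)$. Then the hierarchical order induced by $\Gamma$ on $\Pi$ is of the type $Ord(J\setminus X,X)$.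
   Context: Polymatroids. For a finite set $J$ let $\mathcal{P}(J)$ be its power set. An (integer) polymatroid is a pair $(J,h)$ with $h:\mathcal{P}(J)\to\mathbb{N}_0$ such that $h(\emptyset)=0$, $h(X)\le h(Y)$ if $X\subseteq Y$, and $h(X\cap Y)+h(X\cup Y)\le h(X)+h(Y)$. It is uniform if $h(X)=h(Y)$ whenever $|X|=|Y|$; write $h_i=h(X)$ for $|X|=i$. With $m=|J|$, its increment sequence is $\boldsymbol g=(g_0,\dots,g_m)$, $g_i=h_{i+1}-h_i$ for $0\le i\le m-1$ and $g_m=0$; it is a nonincreasing sequence of nonnegative integers, and $g_0>0$ is assumed. Such a polymatroid is written $\mathcal{Z}=(J,h,\boldsymbol g)$. Compatibility. A monotone increasing family $\Delta\subseteq\mathcal{P}(J)\setminus\{\emptyset\}$ is a nonempty family of nonempty subsets of $J$ closed under taking supersets in $J$; $\min\Delta$ is the set of its inclusion-minimal members. Fix $x_0\notin J$ and define $h'$ on $\mathcal{P}(J\cup\{x_0\})$ by $h'(X)=h(X)$ for $X\subseteq J$, $h'(X\cup\{x_0\})=h(X)$ if $X\in\Delta$, and $h'(X\cup\{x_0\})=h(X)+1$ if $X\subseteq J$, $X\notin\Delta$. $\Delta$ is compatible with $\mathcal{Z}$ if $h'$ is monotone increasing and submodular. Access structure. A partition $\Pi=(P_x)_{x\in J}$ of $P$ consists of pairwise disjoint nonempty sets (blocks) with union $P$. For $A\subseteq P$ put $\pi(A)=(|A\cap P_x|)_{x\in J}\in\mathbb{N}_0^J$. For $\bar v\in\mathbb{N}_0^J$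 and $Y\subseteq J$ put $\mathrm{supp}(\bar v)=\{x:v_x\ne0\}$, $|\bar v|=\sum_{x\in J}v_x$, $|\bar v_Y|=\sum_{x\in Y}v_x$. For $X\subseteq J$ let $\mathcal{B}(\mathcal{Z},X)=\{\bar v\in\mathbb{N}_0^J:\mathrm{supp}(\bar v)\subseteq X,\ |\bar v|=h(X),\ |\bar v_Y|\le h(Y)\text{ for all }Y\subseteq X\}$. For $\Delta$ compatible with $\mathcal{Z}$, $\Gamma(\Pi,\mathcal{Z},\Delta)$ is the family of all $A\subseteq P$ such that $\pi(A)\ge\bar v$ (coordinatewise) for some $\bar v\in\bigcup_{X\in\Delta}\mathcal{B}(\mathcal{Z},X)$. Hierarchy. For participants $p,q\in P$ write $q\preccurlyeq p$ if $A\cup\{p\}\in\Gamma$ for all $A\subseteq P\setminus\{p,q\}$ with $A\cup\{q\}\in\Gamma$. For blocks, $P_y\preccurlyeq P_x$ means $q\preccurlyeq p$ for some (equivalently, all) $q\in P_y$, $p\in P_x$; this is a preorder on $\Pi$. For disjoint $Y,X\subseteq J$, the preorder $\preccurlyeq$ on $\Pi$ is of type $Ord(Y,X)$ if for all $a,b\in J$: $P_b\preccurlyeq P_a$ if and only if ($a=b$) or ($b\in Y$ and $a\in X$). *)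

(* Defs.v *)
From HB Require Import structures.
From mathcomp Require Import all_boot.

Set Implicit Arguments.
Unset Strict Implicit.
Unset Printing Implicit Defensive.

Definition monotone_fun (J : finType) (h : {set J} -> nat) : Prop :=
  forall X Y : {set J}, X \subset Y -> h X <= h Y.

Definition submodular (J : finType) (h : {set J} -> nat) : Prop :=
  forall X Y : {set J}, h (X :&: Y) + h (X :|: Y) <= h X + h Y.

Definition polymatroid (J : finType) (h : {set J} -> nat) : Prop :=
  [/\ h set0 = 0, monotone_fun h & submodular h].

Definition uniform (J : finType) (h : {set J} -> nat) : Prop :=
  forall X Y : {set J}, #|X| = #|Y| -> h X = h Y.

(* For uniform h: g_i = h_{i+1} - h_i for i < m = #|J|, written additively
   (truncated subtraction on nat is avoided), and g_m = 0. *)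
Definition increment_sequence (J : finType) (h : {set J} -> nat)
    (g : (#|J|.+1).-tuple nat) : Prop :=
  (forall X Y : {set J}, #|Y| = #|X|.+1 -> h Y = h X + nth 0 g #|X|)
  /\ nth 0 g #|J| = 0.

Definition monotone_family (J : finType) (Delta : {set {set J}}) : Prop :=
  [/\ Delta != set0, set0 \notin Delta &
      forall X Y : {set J}, X \in Delta -> X \subset Y -> Y \in Delta].

Definition min_family (J : finType) (Delta : {set {set J}}) : {set {set J}} :=
  [set X | minset (fun Y : {set J} => Y \in Delta) X].

Definition ksubsets (J : finType) (k : nat) (S : {set J}) : {set {set J}} :=
  [set A : {set J} | A \subset S & #|A| == k].

(* J together with a new point x_0 is [option J], with x_0 = None;
   [Some @^-1: X] is the trace of X on J. *)
Definition extension (J : finType) (h : {set J} -> nat)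
    (Delta : {set {set J}}) (X : {set option J}) : nat :=
  let X' := Some @^-1: X in
  if (None \in X) && (X' \notin Delta) then h X' + 1 else h X'.

Definition compatible (J : finType) (h : {set J} -> nat)
    (Delta : {set {set J}}) : Prop :=
  monotone_fun (extension h Delta) /\ submodular (extension h Delta).

Definition block_partition (J P : finType) (Pi : J -> {set P}) : Prop :=
  [/\ forall x, Pi x != set0,
      forall x y, x != y -> [disjoint Pi x & Pi y] &
      \bigcup_(x : J) Pi x = [set: P]].

Definition profile (J P : finType) (Pi : J -> {set P}) (A : {set P}) :
    {ffun J -> nat} := [ffun x => #|A :&: Pi x|].

Definition supp (J : finType) (v : {ffun J -> nat}) : {set J} :=
  [set x | v x != 0].

(* [bases h X v] : v belongs to B(Z, X). *)
Definition bases (J : finType) (h : {set J} -> nat) (X : {set J})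
    (v : {ffun J -> nat}) : Prop :=
  [/\ supp v \subset X, \sum_(x : J) v x = h X &
      forall Y : {set J}, Y \subset X -> \sum_(x in Y) v x <= h Y].

Definition access_structure (J P : finType) (Pi : J -> {set P})
    (h : {set J} -> nat) (Delta : {set {set J}}) (A : {set P}) : Prop :=
  exists X : {set J}, exists v : {ffun J -> nat},
    [/\ X \in Delta, bases h X v & forall x : J, v x <= profile Pi A x].

(* [hier_le Gamma q p] : q is hierarchically below p. *)
Definition hier_le (P : finType) (Gamma : {set P} -> Prop) (q p : P) : Prop :=
  forall A : {set P}, A \subset ~: [set p; q] ->
    Gamma (q |: A) -> Gamma (p |: A).

(* When membership in Gamma depends only on the profile of a set, the choice of
   q in B and p in C is immaterial. *)
Definition block_le (P : finType) (Gamma : {set P} -> Prop)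
    (B C : {set P}) : Prop :=
  exists q p : P, [/\ q \in B, p \in C & hier_le Gamma q p].

Definition of_type_Ord (J P : finType) (Pi : J -> {set P})
    (Gamma : {set P} -> Prop) (Y X : {set J}) : Prop :=
  [disjoint Y & X] /\
  forall a b : J,
    block_le Gamma (Pi b) (Pi a) <-> (a = b \/ (b \in Y /\ a \in X)).

(* Main.v *)
(* Since g_2 = 0, submodularity makes h constant, equal to g_0 + g_1, on all
   sets of size at least two.  Monotonicity of h' then forces every such set into
   a compatible Delta, so Delta is determined by its singletons, that is, by X;
   submodularity of h' can only fail for two distinct singletons {x}, {y} with
   x, y in X, where it says g_1 < g_0.

   Consequently A is qualified iff it meets some P_x with x in X in at least g_0
   points, or the numbers |A :&: P_x|, truncated at g_0, add up to at least
   g_0 + g_1.  An exchange of q in P_y for p in P_x that destroys qualification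
   is found on a set of profile g_0 - 1 at y (if y is in X), or g_0 at x and
   g_1 - 1 at y (if neither is in X). *)

Require Import Defs.
From HB Require Import structures.
From mathcomp Require Import all_boot.
From mathcomp Require Import zify.

Set Implicit Arguments.
Unset Strict Implicit.
Unset Printing Implicit Defensive.

(** * Sets and vectors of prescribed size, minimal members, and the shape of [h] *)

Lemma exists_card_subset (T : finType) (S : {set T}) (n : nat) :
  n <= #|S| -> exists2 A : {set T}, A \subset S & #|A| = n.
Proof.
move=> nS.
have : 0 < #|[set A : {set T} | A \subset S & #|A| == n]|.
  by rewrite cards_draws bin_gt0.
by case/card_gt0P=> A; rewrite inE => /andP[AS /eqP An]; exists A.
Qed.

(** While the sum of [v] stays below that of [u], some coordinate has slack and can be raised by
    one. *)
Lemma exists_sum_below (T : finType) (u : T -> nat) (n : nat) :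
  n <= \sum_x u x ->
  exists2 v : {ffun T -> nat}, forall x, v x <= u x & \sum_x v x = n.
Proof.
elim: n => [_|n IHn lt_n].
  by exists [ffun=> 0] => [x|]; [rewrite ffunE | apply: big1 => x _; rewrite ffunE].
have [v le_vu sum_v] := IHn (ltnW lt_n).
case: (pickP (fun x => v x < u x)) => [y lt_y|v_ge]; last first.
  suff : \sum_x u x <= \sum_x v x by rewrite sum_v leqNgt lt_n.
  by apply: leq_sum => x _; rewrite leqNgt v_ge.
exists [ffun x => (x == y) + v x] => [x|].
  by rewrite ffunE; case: eqP => [->|_]; rewrite ?add1n ?add0n.
under eq_bigr do rewrite ffunE.
by rewrite big_split /= sum_v (bigD1 y) //= eqxx big1 // => x /negPf ->.
Qed.

(** A set with two points either meets [X] or contains a pair outside [X]. The membership test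
    replaces minimal members in the later arguments. *)
Lemma min_familyP (J : finType) (Delta : {set {set J}}) (X : {set J}) :
  monotone_family Delta ->
  min_family Delta = ksubsets 1 X :|: ksubsets 2 (~: X) <->
  forall S : {set J}, (S \in Delta) = (1 < #|S|) || ~~ [disjoint S & X].
Proof.
move=> [_ D0 Dup]; split=> [minD S|memD].
  have minDE (M : {set J}) : M \in min_family Delta -> M \in Delta.
    by rewrite inE => /minsetp.
  apply/idP/idP => [SD|/orP[S2|]].
  - have [M minM MS] := minset_exists (P := fun Y => Y \in Delta) SD.
    have : M \in min_family Delta by rewrite inE.
    rewrite minD !inE => /orP[/andP[MX /cards1P[x Mx]]|/andP[_ /eqP M2]].
      move: MX MS; rewrite Mx !sub1set => xX xS.
      by apply/orP; right; apply/pred0Pn; exists x; rewrite /= xS.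
    by rewrite -M2 subset_leq_card.
  - case: (boolP [disjoint S & X]) => [dSX|/pred0Pn[x /andP[/= xS xX]]].
      have [B BS B2] := exists_card_subset S2.
      apply: (Dup B) => //; apply: minDE; rewrite minD !inE B2 eqxx andbT.
      by rewrite -disjoints_subset (disjointWl BS) // orbT.
    apply: (Dup [set x]); rewrite ?sub1set //; apply: minDE.
    by rewrite minD !inE sub1set xX cards1.
  case/pred0Pn=> x /andP[/= xS xX].
  apply: (Dup [set x]); rewrite ?sub1set //; apply: minDE.
  by rewrite minD !inE sub1set xX cards1.
apply/setP=> M; rewrite !inE; apply/idP/idP.
  case/minsetP=> MD minM; move: (MD); rewrite memD.
  case: (boolP [disjoint M & X]) => [dMX|/pred0Pn[x /andP[/= xM xX]] _].
    rewrite orbF => M2; have [B BM B2] := exists_card_subset M2.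
    have <- : B = M by apply: minM; rewrite // memD B2.
    by rewrite B2 -disjoints_subset (disjointWl BM) // orbT.
  have <- : [set x] = M.
    apply: minM; rewrite ?sub1set // memD; apply/orP; right.
    by apply/pred0Pn; exists x; rewrite /= set11.
  by rewrite sub1set xX cards1.
case/orP=> /andP[MX /eqP cM]; apply/minsetP.
  have [x Mx] : exists x, M = [set x] by apply/cards1P; rewrite cM.
  move: MX; rewrite Mx sub1set => xX; split.
    by rewrite memD; apply/orP; right; apply/pred0Pn; exists x; rewrite /= set11.
  move=> Y YD; rewrite subset1 => /orP[/eqP //|/eqP Y0].
  by rewrite Y0 (negPf D0) in YD.
split=> [|Y]; first by rewrite memD cM.
rewrite memD => YD YM; apply/eqP; rewrite eqEcard YM cM.
by move: YD; rewrite (disjointWl YM) ?orbF // disjoints_subset.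
Qed.

Lemma rank_card (J : finType) (h : {set J} -> nat) (g : (#|J|.+1).-tuple nat) :
  polymatroid h -> increment_sequence h g -> nth 0 g 2 = 0 ->
  forall S : {set J},
    h S = (0 < #|S|) * nth 0 g 0 + (1 < #|S|) * nth 0 g 1.
Proof.
move=> [h0 hmon hsub] [hg _] g2 S.
elim: {S}#|S| {-2}S (erefl #|S|) => [|n IHn] S cS.
  by rewrite (cards0_eq cS) cards0 h0.
have [x xS] : exists x, x \in S by apply/card_gt0P; rewrite cS.
have cSx : #|S :\ x| = n by have := cardsD1 x S; rewrite xS cS; lia.
case: n => [|[|n]] in IHn cS cSx *.
- by rewrite (hg (S :\ x)) cSx // (IHn _ cSx); lia.
- by rewrite (hg (S :\ x)) cSx // (IHn _ cSx); lia.
(* Submodularity for [S :\ x] and [x |: B], which meet in the pair [B] and cover [S], carries the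
   vanishing of [g_2] to all larger sizes: adding [x] to [S :\ x] gains no more than adding it to
   [B]. *)
have [B BS B2] : exists2 B : {set J}, B \subset S :\ x & #|B| = 2.
  by apply: exists_card_subset; rewrite cSx.
have xB : x \notin B by apply: contraL BS => xB; apply/subsetPn; exists x; rewrite ?inE ?eqxx.
have BxE : h (x |: B) = h B by rewrite (hg B) ?cardsU1 ?xB ?B2 // g2 addn0.
have BI : (S :\ x) :&: (x |: B) = B.
  apply/setP=> y; rewrite !inE; have := subsetP BS y; rewrite !inE.
  by case: eqP => [->|_]; rewrite ?(negPf xB) //=; case: (y \in B) => [->|_]; rewrite ?andbT ?andbF.
have BU : (S :\ x) :|: (x |: B) = S.
  apply/setP=> y; rewrite !inE; have := subsetP BS y; rewrite !inE.
  by case: eqP => [->|_] /=; case: (y \in B) => [Sy|_]; rewrite ?xS ?orbF // Sy.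
have := hsub (S :\ x) (x |: B); rewrite BI BU BxE.
have := hmon _ _ (subsetDl S [set x]).
by rewrite (IHn _ cSx); lia.
Qed.

Lemma extension_setU1 (J : finType) (h : {set J} -> nat) (Delta : {set {set J}})
    (S : {set J}) :
  extension h Delta (None |: Some @: S) = h S + (S \notin Delta).
Proof.
rewrite /extension; suff -> : Some @^-1: (None |: Some @: S) = S.
  by rewrite !inE /=; case: (S \in Delta); rewrite /= ?addn0.
by apply/setP=> z; rewrite !inE mem_imset //; apply: Some_inj.
Qed.

(** * Counting participants block by block *)

Section Blocks.

Variables (J P : finType) (Pi : J -> {set P}).
Hypothesis PiP : block_partition Pi.

Lemma mem_block (p : P) (x y : J) : p \in Pi x -> (p \in Pi y) = (y == x).
Proof.
move=> px; case: eqP => [->|/eqP nyx] //; have [_ dP _] := PiP.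
by have := disjointFl (dP _ _ nyx) px.
Qed.

Lemma card_setU1_block (A : {set P}) (p : P) (x y : J) :
  p \notin A -> p \in Pi x ->
  #|(p |: A) :&: Pi y| = (y == x) + #|A :&: Pi y|.
Proof.
move=> pA px; rewrite setIUl; case: (boolP (p \in Pi y)) => py.
  by rewrite (setIidPl _) ?sub1set // cardsU1 !inE (negPf pA) -(mem_block y px) py.
rewrite disjoint_setI0 ?disjoints1 // set0U -(mem_block y px) (negPf py) //.
Qed.

(** Supplies the test sets for exchanging [q] for [p]; the strict bounds leave room to omit [p] and
    [q]. *)
Lemma exists_set_two_blocks (p q : P) (x y : J) (i j : nat) :
  x != y -> p \in Pi x -> q \in Pi y -> i < #|Pi x| -> j < #|Pi y| ->
  exists A : {set P}, [/\ A \subset ~: [set p; q], #|A :&: Pi x| = i,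
    #|A :&: Pi y| = j & forall z, z != x -> z != y -> #|A :&: Pi z| = 0].
Proof.
move=> nxy px qy ia ja.
have [B Bx Bi] : exists2 B : {set P}, B \subset Pi x :\ p & #|B| = i.
  by apply: exists_card_subset; have := cardsD1 p (Pi x); lia.
have [C Cy Cj] : exists2 C : {set P}, C \subset Pi y :\ q & #|C| = j.
  by apply: exists_card_subset; have := cardsD1 q (Pi y); lia.
have BE z : B :&: Pi z = if z == x then B else set0.
  apply/setP=> r; rewrite !inE; case: (boolP (r \in B)) => [rB|rB] /=; last first.
    by case: ifP; rewrite ?inE // (negPf rB).
  have := subsetP Bx r rB; rewrite !inE => /andP[_ rx].
  by rewrite (mem_block z rx); case: ifP; rewrite ?inE.
have CE z : C :&: Pi z = if z == y then C else set0.
  apply/setP=> r; rewrite !inE; case: (boolP (r \in C)) => [rC|rC] /=; last first.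
    by case: ifP; rewrite ?inE // (negPf rC).
  have := subsetP Cy r rC; rewrite !inE => /andP[_ ry].
  by rewrite (mem_block z ry); case: ifP; rewrite ?inE.
exists (B :|: C); split=> [||| z nzx nzy]; rewrite ?setIUl ?BE ?CE.
- apply/subsetP=> r; rewrite !inE negb_or => /orP[rB|rC].
    have := subsetP Bx r rB; rewrite !inE => /andP[-> rx] /=.
    by apply: contraNneq nxy => rq; rewrite -(mem_block x qy) -rq.
  have := subsetP Cy r rC; rewrite !inE => /andP[-> ry] /=.
  by rewrite andbT; apply: contraNneq nxy => rp; rewrite eq_sym -(mem_block y px) -rp.
- by rewrite eqxx (negPf nxy) setU0.
- by rewrite eqxx eq_sym (negPf nxy) set0U.
- by rewrite (negPf nzx) (negPf nzy) setU0 cards0.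
Qed.

End Blocks.

(** * Compatibility when [h] has increments [a], [b] and then zeros *)

Section RankTwo.

Variables (J : finType) (h : {set J} -> nat) (a b : nat).
Hypothesis hE : forall S : {set J}, h S = (0 < #|S|) * a + (1 < #|S|) * b.

Lemma compatible_mem_card_gt1 (Delta : {set {set J}}) :
  monotone_family Delta -> monotone_fun (extension h Delta) ->
  forall S : {set J}, 1 < #|S| -> S \in Delta.
Proof.
move=> [/set0Pn[D DD] _ Dup] emon S S2; apply/negPn/negP => SD.
(* With [S] outside [Delta], the extension is [a + b + 1] at [S] plus the new point, but only
   [a + b] at the full set. *)
have := emon (None |: Some @: S) setT (subsetT _).
rewrite extension_setU1 SD /extension preimsetT (Dup _ _ DD (subsetT D)) andbF !hE cardsT.
by have := max_card S; lia.
Qed.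

Lemma compatible_card_le1 (Delta : {set {set J}}) (X : {set J}) :
  a = b -> monotone_family Delta -> submodular (extension h Delta) ->
  (forall x, x \in X -> [set x] \in Delta) -> #|X| <= 1.
Proof.
move=> eq_ab mD esub XD; rewrite leqNgt; apply/negP => /card_gt1P[x [y [xX yX nxy]]].
(* The intersection is the new point alone, of value 1 since [Delta] omits [set0]. The inequality
   yields [1 + (a + b) <= a + a], false for [a = b]. *)
have := esub (None |: Some @: [set x]) (None |: Some @: [set y]).
have -> : (None |: Some @: [set x]) :|: (None |: Some @: [set y])
          = None |: Some @: [set x; y] by rewrite imsetU setUACA setUid.
have -> : (None |: Some @: [set x]) :&: (None |: Some @: [set y])
          = None |: Some @: (set0 : {set J}).
  rewrite -setUIr -imsetI; last by move=> ? ? _ _ [].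
  by rewrite disjoint_setI0 // disjoints1 inE.
have [_ D0 _] := mD.
by rewrite !extension_setU1 !XD // D0 !hE cards2 nxy cards0 !cards1; lia.
Qed.

Lemma compatible_of_mem (Delta : {set {set J}}) (X : {set J}) :
  monotone_fun h -> submodular h -> 0 < b -> b <= a ->
  monotone_family Delta -> (b < a) || (#|X| <= 1) ->
  (forall S : {set J}, (S \in Delta) = (1 < #|S|) || ~~ [disjoint S & X]) ->
  compatible h Delta.
Proof.
move=> hmon hsub b_gt0 le_ba [_ D0 Dup] X1 memD.
have extE (S : {set option J}) : extension h Delta S =
    h (Some @^-1: S) + (None \in S) * (Some @^-1: S \notin Delta).
  by rewrite /extension; case: (None \in S); case: (_ \in Delta); rewrite /= ?addn0.
have Dle (S T : {set J}) : S \subset T -> (T \notin Delta) <= (S \notin Delta).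
  by move=> ST; case: (boolP (S \in Delta)) => [/Dup/(_ ST) ->|_] //; case: (_ \notin _).
split=> S T; rewrite !extE ?preimsetI ?preimsetU ?inE.
  set S' := Some @^-1: S; set T' := Some @^-1: T => ST.
  have ST' : S' \subset T' := preimsetS _ ST.
  have nST : (None \in S) <= (None \in T).
    by have := subsetP ST None; case: (None \in S) => // ->.
  have := hmon _ _ ST'; case: (boolP (S' \in Delta)) => [_ |SD]; first lia.
  case: (boolP (T' \in Delta)) => [TD|_]; last by nia.
  (* Since [S'] has at most one point and [a], [b] are positive, passing to the larger [T'] raises
     [h] by at least 1, which makes up for the lost unit. *)
  have : #|S'| < #|T'|.
    by apply: proper_card; rewrite properEneq ST' andbT; apply: contraNneq SD => ->.
  by move: SD; rewrite memD negb_or !hE; lia.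
set S' := Some @^-1: S; set T' := Some @^-1: T.
have := hsub S' T'.
have := Dle _ _ (subsetUl S' T'); have := Dle _ _ (subsetUr S' T').
have := Dle _ _ (subsetIl S' T'); have := Dle _ _ (subsetIr S' T').
case: (None \in S); case: (None \in T) => /=; rewrite ?mul1n ?mul0n; try lia.
(* With the new point in both sets, one case is left: both traces in [Delta], their intersection
   outside. There [h] itself must be submodular with one unit to spare. *)
case: (boolP (S' \in Delta)) => SD; case: (boolP (T' \in Delta)) => TD /=; try lia.
case: (boolP (S' :&: T' \in Delta)) => ID /=; try lia.
have -> : S' :|: T' \in Delta by apply: Dup SD (subsetUl _ _).
move=> _ _ _ _ _.
have := cardsUI S' T'.
have ltS : #|S' :&: T'| < #|S'|.
  apply: proper_card; rewrite properEneq subsetIl andbT.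
  by apply: contraNneq ID => ->.
have ltT : #|S' :&: T'| < #|T'|.
  apply: proper_card; rewrite properEneq subsetIr andbT.
  by apply: contraNneq ID => ->.
move: (ID); rewrite memD negb_or => /andP[I1 _].
(* If the traces share exactly one point, each has at least two, and [b > 0] provides the unit. *)
case: (posnP #|S' :&: T'|) => I0; last by rewrite !hE; lia.
(* For disjoint traces the unit comes from [b < a], or from a trace with two points; two disjoint
   singletons would be distinct elements of [X]. *)
case/orP: X1 => X1; first by rewrite !hE; lia.
suff : (1 < #|S'|) || (1 < #|T'|) by rewrite !hE; lia.
apply/negPn/negP; rewrite negb_or => /andP[S1 T1].
move: SD TD; rewrite !memD (negPf S1) (negPf T1) /=.
move=> /pred0Pn[x /andP[/= xS xX]] /pred0Pn[y /andP[/= yT yX]].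
have xy : x = y by apply: (card_le1_eqP X1).
by have := cards0_eq I0 => /setP/(_ x); rewrite in_setI in_set0 xS xy yT.
Qed.

(** * Qualified sets and the hierarchical order *)

Section Access.

Variables (P : finType) (Pi : J -> {set P}).
Variables (Delta : {set {set J}}) (X : {set J}).
Hypothesis Jge2 : 2 <= #|J|.
Hypothesis PiP : block_partition Pi.
Hypothesis memD :
  forall S : {set J}, (S \in Delta) = (1 < #|S|) || ~~ [disjoint S & X].

(* With h rank two, a basis on two or more blocks is any vector of sum [a + b]
   with entries at most [a], so only the profile truncated at [a] matters. *)
Lemma access_structureP (A : {set P}) :
  access_structure Pi h Delta A <->
  (exists2 x, x \in X & a <= #|A :&: Pi x|) \/
  a + b <= \sum_x minn #|A :&: Pi x| a.
Proof.
split=> [[S [v [SD [sup sumv vY] vA]]]|[[x xX ax]|le_sum]].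
- have v0 x : x \notin S -> v x = 0.
    move=> xS; apply/eqP/negPn/negP => vx; case/negP: xS.
    by apply: (subsetP sup); rewrite inE.
  case: (ltnP 1 #|S|) => S1.
    right; have -> : a + b = h S by rewrite hE; lia.
    rewrite -sumv; apply: leq_sum => x _; rewrite leq_min.
    have := vA x; rewrite ffunE => -> /=.
    case: (boolP (x \in S)) => [xS|/v0 ->] //.
    by have := vY [set x]; rewrite sub1set big_set1 hE cards1 => /(_ xS); lia.
  (* A member of [Delta] with at most one point is a singleton from [X], so the basis puts its whole
     weight [a] there. *)
  left; move: SD; rewrite memD ltnNge S1 /= => /pred0Pn[x /andP[/= xS xX]].
  exists x => //; have := vA x; rewrite ffunE; apply: leq_trans.
  have -> : a = h S.
    have : 0 < #|S| by apply/card_gt0P; exists x.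
    by rewrite hE; lia.
  rewrite -sumv (bigD1 x) //= big1 ?addn0 // => y nyx; apply: v0.
  by apply: contraNN nyx => yS; apply/eqP/(card_le1_eqP S1).
- exists [set x], [ffun y => (y == x) * a]; split.
  + by rewrite memD; apply/orP; right; apply/pred0Pn; exists x; rewrite /= set11.
  + split.
    * by apply/subsetP=> y; rewrite !inE ffunE; case: (y == x).
    * under eq_bigr do rewrite ffunE.
      rewrite (bigD1 x) //= eqxx big1 ?hE ?cards1; first lia.
      by move=> y /negPf ->.
    * move=> Y; rewrite subset1 => /orP[]/eqP ->; last by rewrite big_set0.
      by rewrite big_set1 ffunE eqxx hE cards1; lia.
  + by move=> y; rewrite !ffunE; case: eqP => [->|_]; rewrite ?mul1n.
have [v lev sumv] := exists_sum_below le_sum.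
(* The full set has rank [a + b] because [2 <= #|J|]; the truncation at [a] settles the rank
   condition on singletons. *)
exists setT, v; split.
- by rewrite memD cardsT; lia.
- split; [exact: subsetT | by rewrite sumv hE cardsT; lia |].
  move=> Y _; case: (ltnP 1 #|Y|) => Y1.
    have -> : h Y = \sum_x v x by rewrite sumv hE; lia.
    by rewrite [leqRHS](bigID [in Y]) /= leq_addr.
  case: (posnP #|Y|) => [/cards0_eq ->|Y0]; first by rewrite big_set0.
  have /cards1P[x ->] : #|Y| == 1 by rewrite eqn_leq Y1.
  rewrite big_set1 hE cards1; have := lev x; lia.
- by move=> x; rewrite ffunE; have := lev x; lia.
Qed.

(** Adding [q] raises the truncated sum by at most 1. Adding [p] raises it by exactly 1, unless [A]
    already has [a] points in [Pi x], which qualifies it as [x \in X]. *)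
Lemma block_le_of_mem (x y : J) :
  y \notin X -> x \in X -> block_le (access_structure Pi h Delta) (Pi y) (Pi x).
Proof.
move=> yX xX; have [nz _ _] := PiP.
have [/set0Pn[q qy] /set0Pn[p px]] := (nz y, nz x).
exists q, p; split=> // A; rewrite subsetC => sA.
have pA : p \notin A by have := subsetP sA p; rewrite !inE eqxx /= => ->.
have qA : q \notin A by have := subsetP sA q; rewrite !inE eqxx orbT /= => ->.
rewrite !access_structureP => -[[z zX]|].
  rewrite (card_setU1_block PiP z qA qy) => zA; left; exists z => //.
  rewrite (card_setU1_block PiP z pA px); move: zA.
  by rewrite (_ : (z == y) = false) ?leq_addl //; [lia | apply: contraNF yX => /eqP <-].
move=> le_q; case: (leqP a #|A :&: Pi x|) => ax.
  by left; exists x => //; rewrite (card_setU1_block PiP x pA px); lia.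
right; apply: (leq_trans le_q).
apply: (@leq_trans (1 + \sum_z minn #|A :&: Pi z| a)).
  rewrite [in leqRHS](bigD1 y) //= (bigD1 y) //= addnA leq_add //.
    by rewrite (card_setU1_block PiP y qA qy); lia.
  by apply: leq_sum => z /negPf nzy; rewrite (card_setU1_block PiP z qA qy) nzy.
rewrite (bigD1 x) //= [in leqRHS](bigD1 x) //= addnA leq_add //.
  by rewrite (card_setU1_block PiP x pA px) eqxx; lia.
by apply: leq_sum => z /negPf nzx; rewrite (card_setU1_block PiP z pA px) nzx.
Qed.

Lemma access_two_blocks (A : {set P}) (x y : J) :
  0 < a -> x != y -> (forall z, z != x -> z != y -> #|A :&: Pi z| = 0) ->
  access_structure Pi h Delta A <->
  [\/ (x \in X) && (a <= #|A :&: Pi x|), (y \in X) && (a <= #|A :&: Pi y|) |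
      a + b <= minn #|A :&: Pi x| a + minn #|A :&: Pi y| a].
Proof.
move=> a_gt0 nxy A0; rewrite access_structureP.
have -> : \sum_z minn #|A :&: Pi z| a = minn #|A :&: Pi x| a + minn #|A :&: Pi y| a.
  rewrite (bigD1 x) //= (bigD1 y) ?(eq_sym y) //= big1 ?addn0 //.
  by move=> z /andP[zx zy]; rewrite A0 ?min0n.
split=> [[[z zX az]|]|[/andP[]|/andP[]|]].
- case: (eqVneq z x) => [<-|nzx]; first by constructor 1; rewrite zX.
  case: (eqVneq z y) => [<-|nzy]; first by constructor 2; rewrite zX.
  (* A third block contributes no points, and [a > 0] excludes it. *)
  by move: az; rewrite A0 //; lia.
- by constructor 3.
- by left; exists x.
- by left; exists y.
- by right.
Qed.

Lemma block_le_inv (x y : J) :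
  0 < b -> b <= a -> (forall z, a < #|Pi z|) -> (b < a) || (#|X| <= 1) ->
  block_le (access_structure Pi h Delta) (Pi y) (Pi x) ->
  x = y \/ (y \notin X /\ x \in X).
Proof.
move=> b_gt0 le_ba Pi_gt X1 [q [p [qy px le_qp]]].
case: (eqVneq x y) => [->|nxy]; [by left | right].
(* Turns the exchange into arithmetic on the numbers [i] and [j] of points of [A] in [Pi x] and
   [Pi y]. *)
have test i j : i <= a -> j <= a ->
    [\/ (x \in X) && (a <= i), (y \in X) && (a <= j.+1) |
      a + b <= minn i a + minn j.+1 a] ->
    [\/ (x \in X) && (a <= i.+1), (y \in X) && (a <= j) |
      a + b <= minn i.+1 a + minn j a].
  move=> ia ja; have [A [sA Ax Ay A0]] := exists_set_two_blocks PiP nxy px qy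
    (leq_ltn_trans ia (Pi_gt x)) (leq_ltn_trans ja (Pi_gt y)).
  have := le_qp A sA.
  have pA : p \notin A by move: sA; rewrite subsetC => /subsetP/(_ p); rewrite !inE eqxx => ->.
  have qA : q \notin A.
    by move: sA; rewrite subsetC => /subsetP/(_ q); rewrite !inE eqxx orbT => ->.
  rewrite !(access_two_blocks (leq_trans b_gt0 le_ba) nxy) => [|z zx zy|z zx zy].
  - rewrite !(card_setU1_block PiP _ pA px) !(card_setU1_block PiP _ qA qy).
    by rewrite !eqxx (negPf nxy) eq_sym (negPf nxy) Ax Ay.
  - by rewrite (card_setU1_block PiP _ pA px) (negPf zx) A0.
  - by rewrite (card_setU1_block PiP _ qA qy) (negPf zy) A0.
case: (boolP (y \in X)) => yX.
  have a1 : a.-1.+1 = a by apply: prednK; lia.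
  (* Here [q] completes [a] points in a block of [X]. After the exchange the truncated sum is only
     [a], so [x \in X] and [a = 1]. Then [b = a], so [X] has at most one element, against
     [x != y]. *)
  have := test 0 a.-1 (leq0n a) (leq_pred a).
  rewrite a1 yX leqnn => /(_ (Or32 _ _ isT)) [|/=|]; try lia.
  case/andP=> xX a_le1; case/orP: X1 => X1; first lia.
  by rewrite (card_le1_eqP X1 _ _ xX yX) eqxx in nxy.
case: (boolP (x \in X)) => xX //.
have b1 : b.-1.+1 = b by apply: prednK.
(* [Pi x] is already at the truncation bound, so [p] leaves the truncated sum at [a + b - 1], while
   [q] brings it to [a + b]. *)
have := test a b.-1 (leqnn a) (leq_trans (leq_pred b) le_ba).
rewrite b1 (negPf xX) (negPf yX) /= => sum_lt.
by case: sum_lt; [constructor 3; lia | | | lia].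
Qed.

End Access.

End RankTwo.

Theorem theorem4p6 (J P : finType) (Pi : J -> {set P})
    (h : {set J} -> nat) (g : (#|J|.+1).-tuple nat)
    (Jge2 : 2 <= #|J|)
    (PiP : block_partition Pi)
    (hP : polymatroid h) (hU : uniform h) (hg : increment_sequence h g)
    (g10 : nth 0 g 1 <= nth 0 g 0) (g1pos : 0 < nth 0 g 1)
    (g2 : nth 0 g 2 = 0)
    (g0lt : forall x : J, nth 0 g 0 < #|Pi x|) :
  [/\ nth 0 g 1 < nth 0 g 0 ->
        forall Delta : {set {set J}}, monotone_family Delta ->
          (compatible h Delta <->
           exists X : {set J},
             min_family Delta = ksubsets 1 X :|: ksubsets 2 (~: X)),
      nth 0 g 0 = nth 0 g 1 ->
        forall Delta : {set {set J}}, monotone_family Delta ->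
          (compatible h Delta <->
           exists X : {set J}, #|X| <= 1 /\
             min_family Delta = ksubsets 1 X :|: ksubsets 2 (~: X)) &
      forall (Delta : {set {set J}}) (X : {set J}),
        monotone_family Delta -> compatible h Delta ->
        min_family Delta = ksubsets 1 X :|: ksubsets 2 (~: X) ->
        of_type_Ord Pi (access_structure Pi h Delta) (~: X) X].
Proof.
have [h0 hmon hsub] := hP.
have hE := rank_card hP hg g2.
have mem_of_compat Delta : monotone_family Delta -> compatible h Delta ->
    min_family Delta =
      ksubsets 1 [set x | [set x] \in Delta] :|:
      ksubsets 2 (~: [set x | [set x] \in Delta]).
  move=> mD [emon _]; apply/min_familyP => // S.
  have D2 := compatible_mem_card_gt1 hE mD emon; have [_ D0 Dup] := mD.
  case: (ltnP 1 #|S|) => [/D2 //|S1] /=.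
  case: (posnP #|S|) => [/cards0_eq ->|S0].
    by rewrite (negPf D0) -setI_eq0 set0I eqxx.
  have /cards1P[x ->] : #|S| == 1 by rewrite eqn_leq S1.
  by rewrite disjoints1 inE negbK.
have compat_card Delta X : nth 0 g 0 = nth 0 g 1 ->
    monotone_family Delta -> compatible h Delta ->
    min_family Delta = ksubsets 1 X :|: ksubsets 2 (~: X) -> #|X| <= 1.
  move=> g01 mD [_ esub] minD; have memD := (min_familyP X mD).1 minD.
  apply: (compatible_card_le1 hE g01 mD esub) => x xX.
  by rewrite memD disjoints1 xX orbT.
split=> [g_lt Delta mD|g_eq Delta mD|Delta X mD cD minD].
- split=> [cD|[X minD]]; first by eexists; apply: mem_of_compat.
  apply: (compatible_of_mem hE hmon hsub g1pos g10 mD (X := X)).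
    by rewrite g_lt.
  exact: (min_familyP X mD).1.
- split=> [cD|[X [X1 minD]]].
    have minD := mem_of_compat _ mD cD.
    by eexists; split; [apply: compat_card minD | exact: minD].
  apply: (compatible_of_mem hE hmon hsub g1pos g10 mD (X := X)).
    by rewrite X1 orbT.
  exact: (min_familyP X mD).1.
have memD := (min_familyP X mD).1 minD.
(* Compatibility bounds [X] when [g_0 = g_1], so the alternative needed for the test profiles holds
   in both cases. *)
have X1 : (nth 0 g 1 < nth 0 g 0) || (#|X| <= 1).
  case: (ltnP (nth 0 g 1) (nth 0 g 0)) => //= g01.
  by apply: compat_card mD cD minD; apply/eqP; rewrite eqn_leq g01.
split=> [|x y]; first by rewrite disjoints_subset.
rewrite inE; split.
  exact: (block_le_inv hE Jge2 PiP memD g1pos g10 g0lt X1).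
case=> [->|[yX xX]]; last exact: (block_le_of_mem hE Jge2 PiP memD).
have [nz _ _] := PiP; have /set0Pn[p py] := nz y.
by exists p, p; split=> // A.
Qed.
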